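(* Let $z, x_1, \ldots, x_\ell \in \mathbb{R}^d$ with $\ell \ge d + 1$ and $P = \operatorname{co}\{x_1, \ldots, x_\ell\}$. Then the meta-algorithm with the steepest descent exchange rule (with subpolytope size $s = d+1$ and $q = 1$ exchanged point, as described in the context) terminates after a finite number of iterations and returns an optimal solution of the problem $$\min_x \|x - z\| \quad \text{subject to} \quad x \in P.$$
   Context: $\|\cdot\|$ is the Euclidean norm, $\operatorname{co}$ denotes convex hull, $I = \{1, \ldots, \ell\}$. Meta-algorithm with the steepest descent exchange rule. Initialization: put $n = 0$, choose any index set $I_0 \subseteq I$ with $|I_0| = d + 1$, and define $P_0 = \operatorname{co}\{x_i \mid i \in I_0\}$. Step 1: compute the Euclidean projection $y_n = \arg\min_{x \in P_n} \|x - z\|$ of $z$ onto $P_n$. If $\langle y_n - z, x_i - y_n \rangle \ge 0$ for all $i \in I$, return $y_n$ and stop. Step 2 (steepest descent exchange rule): find (any) $i_{1n} \in I_n$ such that $y_n \in \operatorname{co}\{x_i \mid i \in I_n \setminus \{i_{1n}\}\}$, and (any) $i_{2n} \in I$ such that $\langle y_n - z, x_{i_{2n}} \rangle = \min_{i \in I} \langle y_n - z, x_i \rangle$. (Such $i_{1n}$ exists whenever the condition of Step 1 fails.) Define $I_{n+1} = (I_n \setminus \{i_{1n}\}) \cup \{i_{2n}\}$, $P_{n+1} = \operatorname{co}\{x_i \mid i \in I_{n+1}\}$. Increase $n$ by $1$ and go to Step 1. *)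

(* Defs.v *)
From mathcomp Require Import all_boot all_order all_algebra.
From mathcomp Require Import all_classical all_reals convex.
From Stdlib Require Export Relation_Operators.

Set Implicit Arguments.
Unset Strict Implicit.
Unset Printing Implicit Defensive.

Import Order.TTheory GRing.Theory Num.Theory.
Local Open Scope classical_set_scope.
Local Open Scope ring_scope.

Section Euclidean.
Context {R : realType} {d : nat}.
Implicit Types u v : 'rV[R]_d.

Definition dot u v : R := \sum_(k < d) u 0 k * v 0 k.

(* The library's norm on row vectors is the sup norm. *)
Definition enorm u : R := Num.sqrt (dot u u).

Definition co (A : set 'rV[R]_d) : set 'rV[R]_d :=
  smallest (@convex_set R 'rV[R]_d) A.

End Euclidean.

Definition is_argmin {R : realType} {T : Type} (f : T -> R) (A : set T)
    (a : T) : Prop :=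
  A a /\ forall b, A b -> f a <= f b.

Section MetaAlgorithm.
Context {R : realType} {d l : nat} (z : 'rV[R]_d) (x : 'I_l -> 'rV[R]_d).

Definition subpolytope (J : {set 'I_l}) : set 'rV[R]_d :=
  co [set x i | i in [set` J]].

Definition stop_cond (y : 'rV[R]_d) : Prop :=
  forall i : 'I_l, 0 <= dot (y - z) (x i - y).

(* Step 1 projects z onto the current subpolytope and tests optimality; Step 2
   exchanges one index. A state names the step about to be executed, with the
   current index set and, before Step 2, the current projection. *)
Inductive state : Type :=
| Start
| AtStep1 of {set 'I_l}
| AtStep2 of {set 'I_l} & 'rV[R]_d
| Returned of 'rV[R]_d.

(* A relation, since the initial index set, the removed index [i1] and the
   steepest descent index [i2] are chosen arbitrarily among those allowed. *)
Inductive step : state -> state -> Prop :=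
| step_init (I0 : {set 'I_l}) :
    #|I0| = d.+1 ->
    step Start (AtStep1 I0)
| step_stop (J : {set 'I_l}) (y : 'rV[R]_d) :
    is_argmin (fun p => enorm (p - z)) (subpolytope J) y ->
    stop_cond y ->
    step (AtStep1 J) (Returned y)
| step_continue (J : {set 'I_l}) (y : 'rV[R]_d) :
    is_argmin (fun p => enorm (p - z)) (subpolytope J) y ->
    ~ stop_cond y ->
    step (AtStep1 J) (AtStep2 J y)
| step_exchange (J : {set 'I_l}) (y : 'rV[R]_d) (i1 i2 : 'I_l) :
    i1 \in J ->
    subpolytope (J :\ i1)%SET y ->
    is_argmin (fun i => dot (y - z) (x i)) setT i2 ->
    step (AtStep2 J y) (AtStep1 (i2 |: (J :\ i1))%SET).

Definition reachable : state -> Prop := clos_refl_trans state step Start.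

End MetaAlgorithm.

Arguments Start {R d l}.
Arguments AtStep1 {R d l} _.
Arguments AtStep2 {R d l} _ _.
Arguments Returned {R d l} _.

(* Main.v *)
(* If y is the projection of z onto co {x_i | i in J} and u = y - z, then
   <u, x_i - y> >= 0 for i in J; so a violated stopping test yields a vertex
   x_i2 with <u, x_i2 - y> < 0. The vertices carrying y with positive weight lie
   in the hyperplane <u, . - y> = 0, so d + 1 of them are affinely dependent and
   a Caratheodory reduction removes one. The next polytope contains y and x_i2,
   hence points strictly closer to z: the distance to z strictly decreases, and
   since there are finitely many index sets the execution is finite. When the
   test succeeds, P lies in the half-space <u, . - y> >= 0, so y is optimal. *)
Require Import Defs.
From mathcomp Require Import all_boot all_order all_algebra.
From mathcomp Require Import all_classical all_reals convex.
From mathcomp Require Import interval_inference topology normedtype derive.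
From mathcomp Require Import ring lra.

Set Implicit Arguments.
Unset Strict Implicit.
Unset Printing Implicit Defensive.

Import Order.TTheory GRing.Theory Num.Theory.
Import numFieldNormedType.Exports.
Local Open Scope classical_set_scope.
Local Open Scope ring_scope.

(** * Bilinearity of the dot product and comparison of norms through squares *)

Section DotProduct.
Variables (R : realType) (d : nat).
Implicit Types u v w : 'rV[R]_d.

Lemma dotE u v : dot u v = (u *m v^T) 0 0.
Proof. by rewrite mxE; apply: eq_bigr => k _; rewrite mxE. Qed.

Lemma dotC u v : dot u v = dot v u.
Proof. by apply: eq_bigr => k _; rewrite mulrC. Qed.

Lemma dotDr u v w : dot u (v + w) = dot u v + dot u w.
Proof. by rewrite !dotE linearD mulmxDr mxE. Qed.

Lemma dotZr a u v : dot u (a *: v) = a * dot u v.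
Proof. by rewrite !dotE linearZ -scalemxAr mxE. Qed.

Lemma dotZl a u v : dot (a *: u) v = a * dot u v.
Proof. by rewrite dotC dotZr dotC. Qed.

Lemma dot0r u : dot u 0 = 0.
Proof. by rewrite -(scale0r 0) dotZr mul0r. Qed.

Lemma dotBr u v w : dot u (v - w) = dot u v - dot u w.
Proof. by rewrite dotDr -scaleN1r dotZr mulN1r. Qed.

Lemma dot_sumr (I : finType) u (f : I -> 'rV[R]_d) :
  dot u (\sum_i f i) = \sum_i dot u (f i).
Proof.
rewrite dotE linear_sum mulmx_sumr summxE.
by apply: eq_bigr => i _; rewrite dotE.
Qed.

Lemma dot_ge0 u : 0 <= dot u u.
Proof. by apply: sumr_ge0 => k _; rewrite -expr2 sqr_ge0. Qed.

Lemma dot_sqrD u v :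
  dot (u + v) (u + v) = dot u u + dot u v *+ 2 + dot v v.
Proof.
by rewrite dotDr !(dotC (u + v)) !dotDr (dotC v u) mulr2n !addrA.
Qed.

Lemma ler_enorm u v : (enorm u <= enorm v) = (dot u u <= dot v v).
Proof. by rewrite /enorm ler_sqrt// dot_ge0. Qed.

Lemma ltr_enorm u v : (enorm u < enorm v) = (dot u u < dot v v).
Proof. by rewrite !ltNge ler_enorm. Qed.

End DotProduct.

(** * Convex hulls and the variational inequality of the projection *)

Section ConvexHull.
Variables (R : realType) (d : nat).
Implicit Types (A : set 'rV[R]_d) (y p z : 'rV[R]_d).

Lemma convex_setP A : @convex_set R 'rV[R]_d A <->
  forall y p (t : R), A y -> A p -> 0 <= t <= 1 -> A (t *: y + (1 - t) *: p).
Proof.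
split=> [cA y p t Ay Ap /andP[t0 t1]|cA y p t /set_mem Ay /set_mem Ap].
  have := cA y p (Itv01 t0 t1) (mem_set Ay) (mem_set Ap).
  by move/set_mem.
apply/mem_set/cA => //; apply/andP; split; [exact: ge0|exact: le1].
Qed.

Lemma convex_co A : @convex_set R 'rV[R]_d (co A).
Proof.
apply/convex_setP => y p t yA pA t01 B [cB AB].
by move/convex_setP: (cB); apply => //; [apply: yA | apply: pA].
Qed.

Lemma sub_co A : A `<=` co A.
Proof. by move=> p Ap B [_]; apply. Qed.

Lemma co_min A (B : set 'rV[R]_d) :
  @convex_set R 'rV[R]_d B -> A `<=` B -> co A `<=` B.
Proof. by move=> cB AB p; apply. Qed.

Lemma co_mono A (B : set 'rV[R]_d) : A `<=` B -> co A `<=` co B.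
Proof.
by move=> AB; apply: co_min; [exact: convex_co|apply: subset_trans (@sub_co B)].
Qed.

(** Along the segment from [y] to [p] the squared distance to [z] has negative slope at [y], so a
    suitable step towards [p] shortens it. *)
Lemma convex_descent A y p z : @convex_set R 'rV[R]_d A ->
  A y -> A p -> dot (y - z) (p - y) < 0 ->
  exists2 q, A q & enorm (q - z) < enorm (y - z).
Proof.
move=> /convex_setP cA Ay Ap neg.
set u := y - z in neg *; set v := p - y in neg.
set a := - dot u v; set b := dot v v.
have a0 : 0 < a by rewrite oppr_gt0.
have b0 : 0 <= b by exact: dot_ge0.
have ab0 : 0 < a + b by rewrite ltr_wpDr.
(* minimises t |-> |u + t v|^2, up to the [a] in the denominator, which keeps
   t <= 1 *)
pose t := a / (a + b).
have t0 : 0 < t by rewrite divr_gt0.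
have t1 : t <= 1 by rewrite ler_pdivrMr// mul1r lerDl.
exists (t *: p + (1 - t) *: y); first by apply: cA => //; rewrite (ltW t0).
have -> : t *: p + (1 - t) *: y - z = u + t *: v.
  by apply/rowP => k; rewrite !mxE; ring.
rewrite ltr_enorm dot_sqrD dotZl !dotZr -/b.
have -> : dot u v = - a by rewrite opprK.
have tb : t * b <= a.
  by rewrite mulrAC ler_pdivrMr// ler_pM2l// lerDr ltW.
nra.
Qed.

Lemma argmin_convex A y p z : @convex_set R 'rV[R]_d A ->
  is_argmin (fun q => enorm (q - z)) A y -> A p -> 0 <= dot (y - z) (p - y).
Proof.
move=> cA [Ay ymin] Ap; rewrite leNgt; apply/negP => neg.
have [q Aq] := convex_descent cA Ay Ap neg.
by rewrite ltNge ymin.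
Qed.

(** The inequality cuts out a half-space, which is convex, so it passes from the generators to the
    hull; expanding the square of [(y - z) + (p - y)] then gives minimality. *)
Lemma argmin_co A y z : co A y ->
  (forall p, A p -> 0 <= dot (y - z) (p - y)) ->
  is_argmin (fun q => enorm (q - z)) (co A) y.
Proof.
move=> Ay yA; split => // p Ap.
have : 0 <= dot (y - z) (p - y).
  move: p Ap; apply: co_min => //.
  apply/convex_setP => p q t p0 q0 /andP[t0 t1].
  rewrite (_ : _ - y = t *: (p - y) + (1 - t) *: (q - y)); last first.
    by apply/rowP => k; rewrite !mxE; ring.
  by rewrite dotDr !dotZr addr_ge0// mulr_ge0// subr_ge0.
have -> : p - z = (y - z) + (p - y) by rewrite [RHS]addrC subrKA.
move=> yp0; rewrite ler_enorm dot_sqrD -addrA lerDl addr_ge0 ?dot_ge0//.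
by rewrite mulrn_wge0.
Qed.

End ConvexHull.

(** * Points of a subpolytope as convex combinations *)

Section Weights.
Variables (R : realType) (d l : nat) (x : 'I_l -> 'rV[R]_d).
Implicit Types (J : {set 'I_l}) (p y u z : 'rV[R]_d) (w : 'I_l -> R).

(** Weights live on all of ['I_l] and vanish off [J], so removing an index of weight zero leaves the
    function unchanged. *)
Definition weights J w :=
  [/\ forall i, 0 <= w i, forall i, i \notin J -> w i = 0 & \sum_i w i = 1].

(** Dividing by the total weight makes the induction go through: the tail is itself a normalised
    combination, and positive weights keep every divisor nonzero. *)
Lemma convex_sum (A : set 'rV[R]_d) (s : seq 'I_l) w :
  @convex_set R 'rV[R]_d A -> s != [::] ->
  (forall i, i \in s -> A (x i) /\ 0 < w i) ->
  A ((\sum_(i <- s) w i)^-1 *: \sum_(i <- s) w i *: x i).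
Proof.
move=> /convex_setP cA; elim: s => // i s IH _ sA.
have [Axi wi] := sA i (mem_head i s).
have [->|s0] := eqVneq s [::].
  by rewrite !big_seq1 scalerA mulVf ?gt_eqF// scale1r.
have sA' j : j \in s -> A (x j) /\ 0 < w j.
  by move=> js; apply: sA; rewrite in_cons js orbT.
have {}IH := IH s0 sA'.
rewrite !big_cons; set S := \sum_(j <- s) w j in IH *.
set X := \sum_(j <- s) _ in IH *.
have S0 : 0 < S.
  rewrite /S; case: s s0 sA' {IH sA S X} => // j s _ sA'.
  rewrite big_cons ltr_pwDl ?(sA' j (mem_head _ _)).2//.
  rewrite big_seq; apply: sumr_ge0 => k ks; apply: ltW.
  by apply: (sA' k _).2; rewrite in_cons ks orbT.
have wS : 0 < w i + S by rewrite addr_gt0.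
rewrite (_ : _ *: (_ + _) =
    (w i / (w i + S)) *: x i + (1 - w i / (w i + S)) *: (S^-1 *: X)).
  apply: cA => //; rewrite divr_ge0 ?(ltW wi) ?(ltW wS)//=.
  by rewrite ler_pdivrMr// mul1r lerDl ltW.
rewrite scalerDr !scalerA; congr (_ *: _ + _ *: _); first by rewrite mulrC.
by field; rewrite !gt_eqF.
Qed.

Lemma subpolytopeP J p : subpolytope x J p <->
  exists2 w, weights J w & p = \sum_i w i *: x i.
Proof.
split.
  move: p; apply: co_min.
    apply/convex_setP => _ _ t [w [w0 wJ w1] ->] [w' [w0' wJ' w1'] ->].
    move=> /andP[t0 t1].
    exists (fun i => t * w i + (1 - t) * w' i).
      split=> [i|i iJ|]; first by rewrite addr_ge0// mulr_ge0// subr_ge0.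
        by rewrite wJ// wJ'// !mulr0 addr0.
      by rewrite big_split/= -!mulr_sumr w1 w1' !mulr1 subrKC.
    rewrite !scaler_sumr -big_split /=; apply: eq_bigr => i _.
    by rewrite !scalerA -scalerDl.
  move=> _ [i /= iJ <-]; exists (fun j => (j == i)%:R).
    split=> [j|j|]; first by case: eqP; rewrite ?ler01.
      by move=> jJ; case: eqP => // ji; rewrite -ji (negPf jJ) in iJ.
    by rewrite (bigD1 i)//= eqxx big1 ?addr0// => j /negbTE ->.
  rewrite (bigD1 i)//= eqxx scale1r big1 ?addr0// => j /negbTE ->.
  by rewrite scale0r.
move=> [w [w0 wJ w1] ->] A [cA JA].
(* Sums are restricted to the support of [w], where the weights are positive as [convex_sum]
   demands. *)
pose s := [seq i <- enum 'I_l | w i != 0].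
have sumE (V : zmodType) (F : 'I_l -> V) : (forall i, w i = 0 -> F i = 0) ->
    \sum_i F i = \sum_(i <- s) F i.
  move=> F0; rewrite big_filter big_enum_cond/=.
  rewrite [RHS]big_mkcond/=; apply: eq_bigr => i _.
  by case: eqP => //= /F0.
have := @convex_sum A s w cA.
rewrite -!sumE// ?w1 => [h|i ->]; last by rewrite scale0r.
rewrite invr1 scale1r in h; apply: h.
  apply: contra_eq_neq w1 => s0; rewrite sumE// s0 big_nil.
  by rewrite eq_sym oner_eq0.
move=> i; rewrite mem_filter => /andP[wi _]; split.
  apply: JA; exists i => //=.
  by apply: contraNT wi => /wJ ->.
by rewrite lt_neqAle eq_sym wi w0.
Qed.

End Weights.

(** * Removal of a vertex and existence of the projection *)

Section Exchange.
Variables (R : realType) (d l : nat) (x : 'I_l -> 'rV[R]_d).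
Implicit Types (J : {set 'I_l}) (p y u z : 'rV[R]_d) (w : 'I_l -> R).

Lemma weights_support_zero J w i : weights J w -> w i = 0 ->
  weights (J :\ i)%SET w.
Proof.
move=> [w0 wJ w1] wi; split => // j; rewrite in_setD1 negb_and negbK.
by case/orP => [/eqP ->//|/wJ].
Qed.

(* The rows [x i - y, 1] indexed by J form a square matrix that annihilates the
   column (u, 0), hence its rows are linearly dependent. *)
Lemma affine_dependence J y u : #|J| = d.+1 -> u != 0 ->
  (forall i, i \in J -> dot u (x i - y) = 0) ->
  exists mu : 'I_l -> R, [/\ exists2 i, i \in J & 0 < mu i,
    forall i, i \notin J -> mu i = 0, \sum_i mu i = 0 &
    \sum_i mu i *: x i = 0].
Proof.
move=> cJ u0 uJ.
(* A nonzero coefficient suffices: were none positive, the numbers [- mu j] would be nonnegative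
   with sum zero, hence all zero. *)
suff [mu [[i iJ mui] muJ mu1 mux]] : exists mu : 'I_l -> R,
    [/\ exists2 i, i \in J & mu i != 0, forall i, i \notin J -> mu i = 0,
      \sum_i mu i = 0 & \sum_i mu i *: x i = 0].
  have [/exists_inP[j jJ muj]|/exists_inPn nmu] :=
      boolP [exists j in J, 0 < mu j].
    by exists mu; split => //; exists j.
  exists mu; split => //; exfalso.
  have mu_le0 j : 0 <= - mu j.
    have [jJ|/muJ ->] := boolP (j \in J); last by rewrite oppr0.
    by rewrite oppr_ge0 leNgt nmu.
  move/eqP: mui; apply; apply/eqP; rewrite -oppr_eq0; apply/eqP.
  apply: (@psumr_eq0P _ _ xpredT (fun j => - mu j)) => //.
  by rewrite sumrN mu1 oppr0.
pose M : 'M[R]_(#|J|, d + 1) :=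
  row_mx (\matrix_(k < #|J|) (x (enum_val k) - y)) (const_mx 1).
pose c : 'cV[R]_(d + 1) := col_mx u^T 0.
have Mc : M *m c = 0.
  rewrite mul_row_col mulmx0 addr0; apply/colP => k; rewrite !mxE.
  rewrite -[RHS](uJ _ (enum_valP k)); apply: eq_bigr => j _.
  by rewrite !mxE mulrC.
have : ~~ row_free M.
  apply: contraNN u0 => freeM; apply/eqP/trmx_inj.
  rewrite trmx0.
  have fullM : row_full M by rewrite /row_full (eqP freeM) cJ addn1.
  have /eqP : c = 0.
    have /row_fullP[B BM] := fullM.
    by rewrite -[c]mul1mx -BM -mulmxA Mc mulmx0.
  by rewrite col_mx_eq0 => /andP[/eqP].
rewrite -kermx_eq0 => /rowV0Pn[v /sub_kermxP vM v0].
have [k vk] : exists k, v 0 k != 0.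
  apply/existsP; rewrite -negb_forall; apply: contra v0 => /forallP v0.
  by apply/eqP/rowP => k; rewrite mxE; apply/eqP.
have i0J := enum_valP k.
pose mu i := if i \in J then v 0 (enum_rank_in i0J i) else 0.
have muE (V : zmodType) (F : 'I_l -> V) : (forall i, mu i = 0 -> F i = 0) ->
    \sum_i F i = \sum_(k < #|J|) F (enum_val k).
  move=> F0; rewrite -(big_enum_val F).
  rewrite [RHS]big_mkcond; apply: eq_bigr => i _; case: ifPn => // iJ.
  by apply: F0; rewrite /mu (negbTE iJ).
have muk k' : mu (enum_val k') = v 0 k'.
  by rewrite /mu enum_valP enum_valK_in.
(* The constant column of [M] yields total weight zero, which turns the relation between the
   [x i - y] into one between the [x i]. *)
move: vM => /eqP; rewrite mul_mx_row row_mx_eq0 => /andP[/eqP vx /eqP v1].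
have mu1 : \sum_i mu i = 0.
  rewrite muE//; transitivity ((v *m const_mx 1 : 'M_1) 0 0).
    by rewrite mxE; apply: eq_bigr => k' _; rewrite muk mxE mulr1.
  by rewrite v1 mxE.
exists mu; split => //.
- by exists (enum_val k); rewrite // muk.
- by move=> i /negbTE iJ; rewrite /mu iJ.
- have : \sum_i mu i *: (x i - y) = 0.
    rewrite muE => [|i ->]; last by rewrite scale0r.
    rewrite -[RHS]vx mulmx_sum_row; apply: eq_bigr => k' _.
    by rewrite muk rowK.
  under eq_bigr do rewrite scalerBr.
  by rewrite sumrB -scaler_suml mu1 scale0r subr0.
Qed.

Lemma drop_vertex J y u : #|J| = d.+1 -> u != 0 -> subpolytope x J y ->
  (forall i, i \in J -> 0 <= dot u (x i - y)) ->
  exists2 i, i \in J & subpolytope x (J :\ i)%SET y.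
Proof.
move=> cJ u0 /subpolytopeP[w wP yE] uJ; have [w0 wJ w1] := wP.
have [/exists_inP[i iJ /eqP wi]|/exists_inPn wn0] :=
    boolP [exists i in J, w i == 0].
  exists i => //; apply/subpolytopeP; exists w => //.
  exact: weights_support_zero.
(* [y] is the [w]-mean of the vertices, so these nonnegative terms sum to zero and each vanishes; no
   weight on [J] being zero, all of [J] lies in the hyperplane. *)
have wdot0 : \sum_i w i * dot u (x i - y) = 0.
  transitivity (dot u (\sum_i w i *: (x i - y))).
    by rewrite dot_sumr; apply: eq_bigr => i _; rewrite dotZr.
  under eq_bigr do rewrite scalerBr.
  by rewrite sumrB -scaler_suml w1 scale1r -yE subrr dot0r.
have uJ0 i : i \in J -> dot u (x i - y) = 0.
  move=> iJ; have /eqP : w i * dot u (x i - y) = 0.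
    apply: (@psumr_eq0P _ _ xpredT (fun j => w j * dot u (x j - y))) => // j _.
    have [jJ|/wJ ->] := boolP (j \in J); last by rewrite mul0r.
    by rewrite mulr_ge0// uJ.
  by rewrite mulf_eq0 (negbTE (wn0 _ iJ)) => /eqP.
have [mu [[i0 i0J mui0] muJ mu1 mux]] := affine_dependence cJ u0 uJ0.
(* the ratio test: the largest step along -mu that keeps the weights
   nonnegative *)
have [i /andP[iJ mui] imin] := @arg_minP _ _ _ i0
  [pred i | (i \in J) && (0 < mu i)] (fun i => w i / mu i)
  (introT andP (conj i0J mui0)).
pose t := w i / mu i.
have t0 : 0 <= t by rewrite divr_ge0// ltW.
exists i => //; apply/subpolytopeP; exists (fun j => w j - t * mu j).
  apply: weights_support_zero; last by rewrite divfK ?subrr ?gt_eqF.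
  split=> [j|j jJ|].
  - rewrite subr_ge0; have [muj|] := ltrP 0 (mu j).
      rewrite -ler_pdivlMr//; apply: imin; rewrite inE/= muj andbT.
      by apply: contraLR muj => /muJ ->; rewrite ltxx.
    by move=> muj; apply: le_trans (w0 j); rewrite mulr_ge0_le0.
  - by rewrite wJ// muJ// mulr0 subr0.
  - by rewrite sumrB -mulr_sumr mu1 mulr0 subr0.
under eq_bigr do rewrite scalerBl -scalerA.
by rewrite sumrB -scaler_sumr mux scaler0 subr0.
Qed.

Lemma compact_weights J : compact
  [set w : 'rV[R]_l | weights J (fun i => w 0 i)].
Proof.
(* The interval shrinks to the point 0 off [J], so this box encodes nonnegativity and support; the
   weights are its intersection with a closed hyperplane. *)
pose B (i : 'I_l) : set R := `[0, if i \in J then 1 else 0]%classic.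
have -> : [set w : 'rV[R]_l | weights J (fun i => w 0 i)] =
    [set w : 'rV[R]_l | forall i, B i (w ord0 i)] `&`
    [set w : 'rV[R]_l | \sum_i w 0 i = 1].
  apply/seteqP; split=> w /= [].
    move=> w0 wJ w1; split => // i; rewrite /B/= in_itv/= w0/=.
    have [iJ|/wJ ->//] := ifPn.
    by rewrite -w1 (bigD1 i)//= lerDl sumr_ge0.
  move=> wB w1; split => // i; have := wB i; rewrite /B /= in_itv/=.
    by case/andP.
  by move=> + /negbTE iJ; rewrite iJ -eq_le => /eqP.
apply: compact_closedI.
  by apply: (@rV_compact R l B) => i; exact: segment_compact.
apply: (@preimage_closed _ _ (fun w : 'rV[R]_l => \sum_i w 0 i) [set 1]).
  move=> w _; apply: continuous_big => [|i _]; first exact: add_continuous.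
  exact: coord_continuous.
exact: closed_eq.
Qed.

(** The squared distance is a continuous function of the weights, which form a compact set; [i]
    makes that set nonempty. *)
Lemma projection_exists J z i : i \in J ->
  exists y, is_argmin (fun p => enorm (p - z)) (subpolytope x J) y.
Proof.
move=> iJ.
pose f (w : 'rV[R]_l) : 'rV[R]_d := \sum_i w 0 i *: x i - z.
have fP p : subpolytope x J p ->
    exists2 w : 'rV[R]_l, weights J (fun i => w 0 i) & p - z = f w.
  move=> /subpolytopeP[w wP ->]; exists (\row_i w i).
    by rewrite (_ : (fun i => _) = w)//; apply/funext => j; rewrite mxE.
  by congr (_ - z); apply: eq_bigr => j _; rewrite mxE.
have [||w /set_mem wP wmin] := @EVT_min_rV R l (fun v => dot (f v) (f v)) _ _
    (@compact_weights J) _.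
- have /fP[w wP _] : subpolytope x J (x i) by apply: sub_co; exists i.
  by exists w.
- apply: continuous_subspaceT; apply: continuous_big => [|k _].
    exact: add_continuous.
  have fk : continuous (fun v => f v 0 k).
    rewrite (_ : (fun v => _) =
        fun v : 'rV[R]_l => \sum_i v 0 i * x i 0 k - z 0 k).
      move=> v; apply: continuousB; last exact: cst_continuous.
      apply: continuous_big => [|j _]; first exact: add_continuous.
      move=> v'; apply: continuousM; last exact: cst_continuous.
      exact: coord_continuous.
    apply/funext => v; rewrite !mxE summxE; congr (_ - _).
    by apply: eq_bigr => j _; rewrite mxE.
  by move=> v; apply: continuousM; apply: fk.
exists (\sum_i w 0 i *: x i); split.
  by apply/subpolytopeP; exists (fun i => w 0 i).
move=> p /fP[v vP pv]; rewrite ler_enorm pv.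
by apply: wmin; apply/mem_set.
Qed.

End Exchange.

(** * Invariant, progress and termination of the algorithm *)

Section Algorithm.
Variables (R : realType) (d l : nat) (z : 'rV[R]_d) (x : 'I_l -> 'rV[R]_d).
Implicit Types (J : {set 'I_l}) (y : 'rV[R]_d).

Definition is_projection J y :=
  is_argmin (fun p => enorm (p - z)) (subpolytope x J) y.

(** The size [d.+1] is what [drop_vertex] requires, and the failed test before Step 2 provides both
    [y != z] and a descent direction. *)
Definition state_inv (s : @state R d l) : Prop :=
  match s with
  | Start => True
  | AtStep1 J => #|J| = d.+1
  | AtStep2 J y => [/\ #|J| = d.+1, is_projection J y & ~ stop_cond z x y]
  | Returned y => (exists J, is_projection J y) /\ stop_cond z x y
  end.

Lemma projection_dot_ge0 J y i : is_projection J y -> i \in J ->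
  0 <= dot (y - z) (x i - y).
Proof.
move=> Jy iJ; apply: (argmin_convex _ Jy); first exact: convex_co.
by apply: sub_co; exists i.
Qed.

Lemma steepest_dot_lt0 y i : ~ stop_cond z x y ->
  is_argmin (fun i => dot (y - z) (x i)) setT i ->
  dot (y - z) (x i - y) < 0.
Proof.
move=> nstop [_ imin]; rewrite ltNge; apply/negP => i0; apply: nstop => j.
by apply: le_trans i0 _; rewrite !dotBr lerD2r imin.
Qed.

Lemma step_inv s s' : step z x s s' -> state_inv s -> state_inv s'.
Proof.
case=> //= [J y Jy ystop _|J y i1 i2 i1J _ i2min [cJ Jy nstop]].
  by split => //; exists J.
(* The entering index is new, since vertices of [J] have nonnegative product with [y - z]; this
   keeps the cardinality at [d.+1]. *)
have i2J : i2 \notin J.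
  apply/negP => /(projection_dot_ge0 Jy).
  by rewrite leNgt steepest_dot_lt0.
rewrite cardsU1 in_setD1 (negbTE i2J) andbF.
by rewrite -cJ (cardsD1 i1 J) i1J.
Qed.

Lemma reachable_inv s : reachable z x s -> state_inv s.
Proof.
move=> reach.
suff : forall s0 s1, clos_refl_trans _ (step z x) s0 s1 ->
    state_inv s0 -> state_inv s1 by move=> /(_ _ _ reach); exact.
move=> s0 s1; elim=> {s0 s1} [s0 s1 /step_inv//|//|s0 s1 s2 _ IH1 _ IH2 s0i].
exact/IH2/IH1.
Qed.

Lemma returned_optimal y : state_inv (Returned y) ->
  is_argmin (fun p => enorm (p - z)) (co (range x)) y.
Proof.
move=> [[J [yJ _]] ystop]; apply: argmin_co.
  by apply: (co_mono _ yJ) => _ [i _ <-]; exists i.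
by move=> _ [i _ <-]; exact: ystop.
Qed.

Lemma step_progress s : (d.+1 <= l)%N -> state_inv s ->
  (exists y, s = Returned y) \/ exists s', step z x s s'.
Proof.
move=> hl; case: s => [_|J /= cJ|J y /= [cJ Jy nstop]|y _]; last by left; exists y.
- right; exists (AtStep1 [set widen_ord hl i | i : 'I_d.+1]%SET).
  apply: step_init; rewrite card_imset ?card_ord// => i j /(congr1 val)/= ij.
  exact/val_inj.
- have /card_gt0P[i iJ] : (0 < #|J|)%N by rewrite cJ.
  right; have [y Jy] := projection_exists x z iJ.
  have [ystop|nstop] := pselect (stop_cond z x y).
    by exists (Returned y); exact: step_stop.
  by exists (AtStep2 J y); exact: step_continue.
- have yz0 : y - z != 0.
    apply/eqP => yz0; apply: nstop => i.
    by rewrite yz0 dotC dot0r.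
  have [i1 i1J yi1] := drop_vertex cJ yz0 Jy.1 (fun i => projection_dot_ge0 Jy).
  have [i2 _ i2min] := @arg_minP _ _ _ i1 xpredT (fun i => dot (y - z) (x i)) isT.
  right; exists (AtStep1 (i2 |: (J :\ i1))%SET); apply: step_exchange => //.
  by split => // i _; apply: i2min.
Qed.

Lemma exchange_decreases J y J' y' : state_inv (AtStep2 J y) ->
  step z x (AtStep2 J y) (AtStep1 J') -> is_projection J' y' ->
  enorm (y' - z) < enorm (y - z).
Proof.
move=> [_ _ nstop] st Jy'.
inversion st as [| | |J0 y0 i1 i2 i1J yi1 i2min]; subst.
have yJ' : subpolytope x (i2 |: (J :\ i1))%SET y.
  apply: (co_mono _ yi1) => _ [i /= iJ <-]; exists i => //=.
  by rewrite finset.in_setU iJ orbT.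
have i2J' : subpolytope x (i2 |: (J :\ i1))%SET (x i2).
  by apply: sub_co; exists i2 => //=; rewrite finset.setU11.
have [q qJ' qy] := convex_descent (@convex_co _ _ _) yJ' i2J'
  (steepest_dot_lt0 nstop i2min).
exact: le_lt_trans (Jy'.2 _ qJ') qy.
Qed.

(** An infinite run would alternate between the two steps forever, with strictly decreasing
    distances. An index set determines its distance, so infinitely many distinct index sets would
    occur. *)
Lemma no_infinite_execution (s : nat -> @state R d l) :
  s 0%N = Start -> ~ forall n, step z x (s n) (s n.+1).
Proof.
move=> s0 sstep.
have sinv n : state_inv (s n).
  by elim: n => [|n]; [rewrite s0 | exact: step_inv].
have next1 n J : s n = AtStep1 J ->
    exists2 y, s n.+1 = AtStep2 J y & is_projection J y.
  move=> sn; have := sstep n; have := sstep n.+1; rewrite sn => st2 st1.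
  inversion st1 as [|J0 y Jy ystop e1 e2|J0 y Jy nstop e1 e2|]; subst.
    by rewrite -e2 in st2; inversion st2.
  by exists y.
have next2 n J y : s n = AtStep2 J y -> exists J', s n.+1 = AtStep1 J'.
  move=> sn; have := sstep n; rewrite sn => st.
  by inversion st; eexists; reflexivity.
have s1 : exists J, s 1%N = AtStep1 J.
  by have := sstep 0%N; rewrite s0 => st; inversion st; eexists; reflexivity.
(* Time 0 is spent on [Start], so Step 1 falls on odd times and Step 2 on positive even times. *)
have odd_s n : exists J, s n.*2.+1 = AtStep1 J.
  elim: n => [//|n [J sn]]; have [y sn1 _] := next1 _ _ sn.
  by rewrite doubleS; exact: next2 sn1.
have [f sf] := choice odd_s.
have even_s n : exists y,
    s n.+1.*2 = AtStep2 (f n) y /\ is_projection (f n) y.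
  by have [y] := next1 _ _ (sf n); exists y.
have [g gP] := choice even_s.
have g_decr : {homo (fun n => enorm (g n - z)) : m n / (m < n)%N >-> n < m}.
  apply: homo_ltn => [r p q pr rq|n]; first exact: lt_trans rq pr.
  have [sn _] := gP n; have [_ gn1] := gP n.+1.
  apply: (@exchange_decreases (f n) _ (f n.+1)) gn1; rewrite -sn -?sf.
    exact: sinv.
  exact: sstep.
(* If the two sets agreed, [g n] would lie in the polytope over which [g m] is closest to [z]. *)
have f_lt m n : (m < n)%N -> f m <> f n.
  move=> /g_decr + fmn; rewrite ltNge => /negP; apply.
  apply: (gP m).2.2; rewrite fmn; exact: (gP n).2.1.
(* Pigeonhole: one more time index than there are index sets. *)
have f_inj : injective (fun i : 'I_(#|{set 'I_l}|.+1) => f i).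
  move=> i j fij; apply/val_inj/eqP; apply/negPn/negP.
  by rewrite neq_ltn => /orP[] /f_lt; rewrite fij.
by have := leq_card _ f_inj; rewrite card_ord ltnn.
Qed.

End Algorithm.

Theorem corollary1 (R : realType) (d l : nat) (z : 'rV[R]_d)
    (x : 'I_l -> 'rV[R]_d) (hl : (d.+1 <= l)%N) :
  (* no infinite execution *)
  (~ exists s : nat -> state,
       s 0%N = Start /\ forall n, step z x (s n) (s n.+1)) /\
  (* an execution can only end by returning a point *)
  (forall s : state, reachable z x s ->
     (exists y, s = Returned y) \/ (exists s', step z x s s')) /\
  (* every returned point is an optimal solution *)
  (forall y : 'rV[R]_d, reachable z x (Returned y) ->
     is_argmin (fun p => enorm (p - z)) (co (range x)) y).
Proof.
split; first by move=> [s [s0 sstep]]; exact: no_infinite_execution sstep.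
split=> [s /reachable_inv|y /reachable_inv]; first exact: step_progress.
exact: returned_optimal.
Qed.
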